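(* Let $n\ge 1$ and consider the convex semi-infinite program $$(\mathrm{P})\qquad \min_{x\in X} f(x)\quad\text{subject to } g(x,u)\le 0 \text{ for all } u\in U,$$ where: (i) $X\subset\mathbb{R}^n$ is closed and convex with nonempty interior; (ii) the feasible set $\{x\in X : g(x,u)\le 0 \text{ for all } u\in U\}$ has nonempty interior; (iii) $f:X\to\mathbb{R}$ is convex and continuous, and has bounded sublevel sets, i.e. $\{x\in X: f(x)\le\alpha\}$ is bounded for every $\alpha\in\mathbb{R}$; (iv) $g:X\times U\to\mathbb{R}$ is jointly upper semi-continuous, and $x\mapsto g(x,u)$ is strictly quasi-convex for each fixed $u\in U$; (v) $U$ is compact. Let $h:X\to\mathbb{R}$ be a positive, strictly convex function and, for $\varepsilon>0$, consider the regularized program $$(\mathrm{P}_\varepsilon)\qquad \min_{x\in X} f(x)+\varepsilon h(x)\quad\text{subject to } g(x,u)\le 0\text{ for all }u\in U .$$ Then the MSA algorithm extracts a minimizing sequence for $(\mathrm{P})$ by solving $(\mathrm{P}_\varepsilon)$ for $\varepsilon\downarrow 0$, and this sequence converges to a solution of $(\mathrm{P})$. That is: for every $\varepsilon>0$ the MSA algorithm applied to $(\mathrm{P}_\varepsilon)$ yields the optimizer $x_\varepsilon$ of $(\mathrm{P}_\varepsilon)$, and for every sequence $\varepsilon_k\downarrow 0$ the values $f(x_{\varepsilon_k})$ converge to the optimal value of $(\mathrm{P})$ and the points $x_{\varepsilon_k}$ converge to a minimizer of $(\mathrm{P})$.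
   Context: The set $U$ (constraint index set) is not required to be finite-dimensional. A function $\phi$ on a convex set is strictly quasi-convex if $\phi(\lambda x+(1-\lambda)y)<\max\{\phi(x),\phi(y)\}$ for all $x\neq y$ and $\lambda\in(0,1)$. MSA algorithm applied to $(\mathrm{P}_\varepsilon)$: define $G_\varepsilon:U^n\to\mathbb{R}$ (where $n$ is the dimension of the space $\mathbb{R}^n\supset X$) by $$G_\varepsilon(u_1,\dots,u_n)=\inf_{x\in X}\{\, f(x)+\varepsilon h(x) : g(x,u_i)\le 0 \text{ for } i=1,\dots,n\,\}.$$ The algorithm finds a global maximizer $(u_1^\circ,\dots,u_n^\circ)$ of $G_\varepsilon$ over $U^n$ and outputs a minimizer of the finitely constrained problem of minimizing $f(x)+\varepsilon h(x)$ over $x\in X$ subject to $g(x,u_i^\circ)\le 0$, $i=1,\dots,n$. A minimizing sequence for $(\mathrm{P})$ is a sequence of feasible points of $(\mathrm{P})$ whose $f$-values converge to the optimal value of $(\mathrm{P})$.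
   Formalization: Added, since the claim fails without them: each set {x in X : g(x,u) ≤ 0} is closed (upper semi-continuity of g does not give this), and h is lower semicontinuous on X (a strictly convex h may jump up at the boundary); also U is assumed nonempty. *)

(* Defs.v *)
From HB Require Import structures.
From mathcomp Require Import all_boot all_order all_algebra.
From mathcomp Require Import all_classical all_reals all_analysis.
Import numFieldNormedType.Exports.
Import Order.TTheory GRing.Theory Num.Theory.

Set Implicit Arguments.
Unset Strict Implicit.
Unset Printing Implicit Defensive.

Local Open Scope classical_set_scope.
Local Open Scope ring_scope.

Section Regularity.
Context {R : realType}.

(* A real function on a set D is represented by a total function of which only
   the values on D matter.  The topology of [subspace D] is the induced one at
   the points of D and is discrete at the other points, so semicontinuity on
   [subspace D] constrains nothing outside D. *)
Definition lsc_on {T : topologicalType} (D : set T) (phi : T -> R) : Prop :=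
  lower_semicontinuous (fun x : subspace D => (phi x)%:E).

Definition usc_on {T : topologicalType} (D : set T) (phi : T -> R) : Prop :=
  lsc_on D (fun x => - phi x).

Definition strictly_convex_on {V : lmodType R} (D : set V) (phi : V -> R) :
    Prop :=
  forall (x y : V) (l : R), D x -> D y -> x != y -> 0 < l < 1 ->
    phi (l *: x + (1 - l) *: y) < l * phi x + (1 - l) * phi y.

Definition strictly_quasiconvex_on {V : lmodType R} (D : set V)
    (phi : V -> R) : Prop :=
  forall (x y : V) (l : R), D x -> D y -> x != y -> 0 < l < 1 ->
    phi (l *: x + (1 - l) *: y) < Num.max (phi x) (phi y).

End Regularity.

Section Programs.
Context {R : realType} {V : Type}.

Definition feasible {I : Type} (X : set V) (c : V -> I -> R) : set V :=
  [set x | X x /\ forall i, c x i <= 0].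

Definition argmin (A : set V) (F : V -> R) : set V :=
  [set x | A x /\ forall y, A y -> F x <= F y].

(* [inf] in a realType is 0 on sets that are empty or not bounded below.  This
   default plays no role for the programs of interest: they have a feasible
   point, and their objective is bounded below on X because f is continuous with
   compact sublevel sets and h is positive. *)
Definition optimal_value (A : set V) (F : V -> R) : R := inf (F @` A).

End Programs.

Section MSA.
Context {R : realType} {n : nat} {U : Type}.
Variables (X : set 'rV[R]_n) (f h : 'rV[R]_n -> R) (g : 'rV[R]_n -> U -> R).

Definition reg_objective (eps : R) (x : 'rV[R]_n) : R := f x + eps * h x.

Definition sampled_feasible (u : 'I_n -> U) : set 'rV[R]_n :=
  feasible X (fun x i => g x (u i)).

Definition msa_G (eps : R) (u : 'I_n -> U) : R :=
  optimal_value (sampled_feasible u) (reg_objective eps).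

Definition msa_maximizers (eps : R) : set ('I_n -> U) :=
  [set u | forall v, msa_G eps v <= msa_G eps u].

(* A run of the algorithm is a choice of a maximizer u followed by a choice of
   a minimizer of the program sampled at u; this is the set of all points that
   some run may return. *)
Definition msa_outputs (eps : R) : set 'rV[R]_n :=
  [set x | exists2 u, msa_maximizers eps u &
             argmin (sampled_feasible u) (reg_objective eps) x].

Definition minimizing_sequence (x_ : nat -> 'rV[R]_n) : Prop :=
  (forall k, feasible X g (x_ k)) /\
  (f \o x_) @ \oo --> optimal_value (feasible X g) f.

End MSA.

(* Main.v *)
Require Import Defs.
From HB Require Import structures.
From mathcomp Require Import all_boot all_order all_algebra.
From mathcomp Require Import all_classical all_reals all_analysis.
From mathcomp Require Import finmap ring lra.
Import numFieldNormedType.Exports.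
Import Order.TTheory GRing.Theory Num.Theory.

Set Implicit Arguments.
Unset Strict Implicit.

Local Open Scope classical_set_scope.
Local Open Scope ring_scope.

(* Write phi = f + eps h and let V be its minimum over the feasible set.  If
every sample u in U^n admitted a sampled-feasible point with phi < V, then its
midpoint with the minimizer of (P_eps) would, by strict quasi-convexity, satisfy
the sampled constraints strictly, hence by upper semicontinuity also at all
samples near u.  By compactness of U^n a single level c < V would serve all
samples, and Helly's theorem, applied to the compact convex set {phi <= c} and
the constraint sets, would give a feasible point with phi <= c.  So some sample
has the value V, the maximal value of G_eps is V, and strict convexity identifies
the minimizer of every maximizing sample with that of (P_eps).

As eps decreases to 0, let x0 minimize h among the minimizers of f.  Comparing
x_eps with x0 gives h(x_eps) <= h(x0) and f(x_eps) <= f(x0) + eps h(x0), and x0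
is the only feasible point at which both bounds hold in the limit. *)

(** * Convex combinations, Radon's argument and Helly's theorem *)

Lemma convex_setP (R : realType) (V : lmodType R) (A : set V) :
  convex_set A <->
  forall x y t, A x -> A y -> 0 <= t -> t <= 1 -> A (t *: x + (1 - t) *: y).
Proof.
split=> [cA x y t Ax Ay t0 t1|cA x y t].
  by apply/set_mem/(cA x y (Itv01 t0 t1)); exact: mem_set.
by move=> /set_mem Ax /set_mem Ay; apply/mem_set; exact: cA.
Qed.

(** Membership is asked only of points of positive weight, because the weights will be the positive
    or negative part of an affine dependence. *)
Lemma convex_set_barycenter (R : realType) (V : lmodType R) (A : set V)
    (I : finType) (w : I -> R) (x : I -> V) :
    convex_set A -> (forall i, 0 <= w i) -> (forall i, 0 < w i -> A (x i)) ->
    0 < \sum_i w i ->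
  A ((\sum_i w i)^-1 *: \sum_i w i *: x i).
Proof.
move=> /convex_setP cA w0 wA.
(* Invariant on a partial weight [s] and a partial weighted sum [v]; the middle clause allows a part
   of total weight zero to be dropped when two parts are merged. *)
pose K (s : R) (v : V) :=
  [/\ 0 <= s, s = 0 -> v = 0 & 0 < s -> A (s^-1 *: v)].
suff : K (\sum_i w i) (\sum_i w i *: x i) by case=> _ _; apply.
apply: (big_ind2 K) => [|s v t z [s0 sv sA] [t0 tz tA]|i _].
- by split=> //; rewrite ltxx.
- split=> [|/eqP|st]; first exact: addr_ge0.
    by rewrite paddr_eq0// => /andP[/eqP/sv -> /eqP/tz ->]; rewrite addr0.
  have [s_eq0|s_neq0] := eqVneq s 0.
    by move: st; rewrite (sv s_eq0) s_eq0 !add0r; exact: tA.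
  have [t_eq0|t_neq0] := eqVneq t 0.
    by move: st; rewrite (tz t_eq0) t_eq0 !addr0; exact: sA.
  have s_gt0 : 0 < s by rewrite lt_neqAle eq_sym s_neq0.
  have t_gt0 : 0 < t by rewrite lt_neqAle eq_sym t_neq0.
  have := cA _ _ (s / (s + t)) (sA s_gt0) (tA t_gt0).
  rewrite !scalerA scalerDr.
  have -> : s / (s + t) / s = (s + t)^-1 by field; rewrite s_neq0 gt_eqF.
  have -> : (1 - s / (s + t)) / t = (s + t)^-1.
    by field; rewrite t_neq0 gt_eqF.
  apply; first by rewrite divr_ge0// ltW.
  by rewrite ler_pdivrMr// mul1r lerDl.
- split=> // [->|wi]; first by rewrite scale0r.
  by rewrite scalerA mulVf ?gt_eqF// scale1r; exact: wA.
Qed.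

(** The rows [(x i, 1)] with [i] in [A] outnumber their dimension [n + 1], so they are linearly
    dependent; the appended coordinate makes the coefficients sum to zero. *)
Lemma affine_dependence (R : fieldType) (n : nat) (I : finType) (A : {set I})
    (x : I -> 'rV[R]_n) :
    (n.+1 < #|A|)%N ->
  exists a : I -> R, [/\ exists i, a i != 0, forall i, i \notin A -> a i = 0,
    \sum_i a i = 0 & \sum_i a i *: x i = 0].
Proof.
move=> nA.
pose M : 'M[R]_(#|A|, n + 1) := \matrix_k row_mx (x (enum_val k)) 1.
have : kermx M != 0.
  by rewrite kermx_eq0 /row_free ltn_eqF// (leq_ltn_trans (rank_leq_col M))// addn1.
case/rowV0Pn => v /sub_kermxP vM vneq0.
have [k vk] : exists k, v 0 k != 0.
  apply/existsP; apply: contraNT vneq0; rewrite negb_exists => /forallP v0.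
  by apply/eqP/rowP => k; rewrite mxE; apply/eqP/negPn/v0.
pose a i := if i \in A then v 0 (enum_rank_in (enum_valP k) i) else 0.
have aE j : a (enum_val j) = v 0 j by rewrite /a enum_valP enum_valK_in.
have a0 i : i \notin A -> a i = 0 by rewrite /a => /negbTE ->.
have axE : \sum_i a i *: row_mx (x i) (1 : 'rV_1) = 0.
  rewrite (bigID (mem A))/= addrC big1 ?add0r; last first.
    by move=> i /a0 ->; rewrite scale0r.
  rewrite big_enum_val -[RHS]vM mulmx_sum_row.
  by apply: eq_bigr => j _; rewrite rowK aE.
exists a; split => //.
- by exists (enum_val k); rewrite aE.
- move/(congr1 rsubmx)/rowP/(_ 0) : axE.
  rewrite linear_sum summxE linear0 mxE => e; rewrite -[RHS]e.
  by apply: eq_bigr => j _; rewrite linearZ/= row_mxKr !mxE eqxx mulr1.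
- move/(congr1 lsubmx) : axE.
  rewrite linear_sum linear0 => e; rewrite -[RHS]e.
  by apply: eq_bigr => j _; rewrite linearZ/= row_mxKl.
Qed.

(* Radon's argument: splitting an affine dependence of the points [x i] by sign
   gives a point in the convex hulls of both parts; each [C j] contains all the
   [x i] of the part to which [j] does not belong. *)
Lemma radon_common_point (R : realType) (n : nat) (I : finType)
    (C : I -> set 'rV[R]_n) (A : {set I}) (x : I -> 'rV[R]_n) :
    (forall i, convex_set (C i)) -> (n.+1 < #|A|)%N ->
    (forall i j, i \in A -> j \in A -> j != i -> C j (x i)) ->
  exists p, forall j, j \in A -> C j p.
Proof.
move=> cC nA xC; have [a [[i0 ai0] a0 sa sax]] := affine_dependence x nA.
pose wp i := Num.max (a i) 0; pose wn i := Num.max (- a i) 0.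
have aE i : a i = wp i - wn i.
  by rewrite /wp /wn; case: (leP (a i)); case: (leP (- a i)); lra.
have wp0 i : 0 <= wp i by rewrite le_max lexx orbT.
have wn0 i : 0 <= wn i by rewrite le_max lexx orbT.
have sE : \sum_i wp i = \sum_i wn i.
  apply/eqP; rewrite -subr_eq0 -sumrB -[X in _ == X]sa; apply/eqP.
  by apply: eq_bigr => i _; rewrite aE.
have sxE : \sum_i wp i *: x i = \sum_i wn i *: x i.
  apply/eqP; rewrite -subr_eq0 -sumrB -[X in _ == X]sax; apply/eqP.
  by apply: eq_bigr => i _; rewrite aE scalerBl.
(* A zero total would force both parts of every coefficient to vanish, against [a i0 != 0]. *)
have s_gt0 : 0 < \sum_i wp i.
  rewrite lt_neqAle sumr_ge0// andbT eq_sym; apply/eqP => s0.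
  have := s0; rewrite sE => s0'.
  move/eqP: ai0; apply; rewrite aE.
  move/eqP: s0; rewrite psumr_eq0// => /allP/(_ i0); rewrite mem_index_enum.
  move/(_ isT)/eqP->.
  move/eqP: s0'; rewrite psumr_eq0// => /allP/(_ i0); rewrite mem_index_enum.
  by move/(_ isT)/eqP->; rewrite subr0.
have wA i : a i != 0 -> i \in A by apply: contra_neqT; exact: a0.
exists ((\sum_i wp i)^-1 *: \sum_i wp i *: x i) => j jA.
(* If [a j <= 0], the index [j] has no weight in the positive part, otherwise none in the negative
   part; so [C j] contains every point that is combined. *)
have [aj|aj] := leP (a j) 0.
  apply: convex_set_barycenter => // i.
  rewrite /wp lt_max ltxx orbF => ai; apply: xC => //.
    by rewrite wA// gt_eqF.
  by apply/eqP => ji; move: ai; rewrite -ji ltNge aj.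
rewrite sxE sE; apply: convex_set_barycenter; rewrite -?sE// => i.
rewrite /wn lt_max ltxx orbF oppr_gt0 => ai; apply: xC => //.
  by rewrite wA// lt_eqF.
by apply/eqP => ji; move: ai; rewrite -ji ltNge ltW.
Qed.

(** Induction on the number of sets: beyond [n.+1] of them, leaving out each index in turn gives a
    smaller family with a common point, and Radon's argument merges these points into one. *)
Theorem helly (R : realType) (n : nat) (I : finType) (C : I -> set 'rV[R]_n) :
    (forall i, convex_set (C i)) ->
    (forall B : {set I}, (#|B| <= n.+1)%N ->
       exists x, forall i, i \in B -> C i x) ->
  exists x, forall i, C i x.
Proof.
move=> cC CB.
suff [x xP] : exists x, forall i, i \in [set: I]%SET -> C i x.
  by exists x => i; apply: xP; rewrite finset.inE.
move: [set: I]%SET => A; have [m] := ubnP #|A|.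
elim: m A => // m IH A; rewrite ltnS => Am.
have [An|nA] := leqP #|A| n.+1; first exact: CB.
have /choice[x xP] : forall i, exists x, i \in A ->
    forall j, j \in A -> j != i -> C j x.
  move=> i; have [iA|iA] := boolP (i \in A); last by exists 0.
  have [|x xP] := IH (A :\ i)%SET.
    by rewrite (leq_trans _ Am)// [X in (_ < X)%N](cardsD1 i) iA.
  by exists x => _ j jA ji; apply: xP; rewrite in_setD1 ji.
by apply: (radon_common_point (x := x) cC nA) => i j iA; exact: xP.
Qed.

Lemma convex_set_distinct (R : realType) (V : lmodType R) (A : set V) :
    (forall x y t, A x -> A y -> x != y -> 0 < t < 1 ->
      A (t *: x + (1 - t) *: y)) ->
  convex_set A.
Proof.
move=> cA; apply/convex_setP => x y t Ax Ay t0 t1.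
have [<-|xy] := eqVneq x y; first by rewrite -scalerDl addrC subrK scale1r.
have [->|tn0] := eqVneq t 0; first by rewrite scale0r add0r subr0 scale1r.
have [->|tn1] := eqVneq t 1; first by rewrite subrr scale0r addr0 scale1r.
by apply: cA => //; rewrite !lt_neqAle eq_sym tn0 t0 tn1.
Qed.

(** Compactness reduces the claim to finite subfamilies. Among any [n.+1] sets, either [C] is absent
    and [z] is common to them, or [C] is present and only [n] constraints remain, which is why
    samples of size [n] suffice. *)
Theorem compact_helly (R : realType) (n : nat) (U : Type) (u0 : U)
    (C : set 'rV[R]_n) (K : U -> set 'rV[R]_n) :
    compact C -> convex_set C -> (forall u, closed (K u)) ->
    (forall u, convex_set (K u)) -> (exists z, forall u, K u z) ->
    (forall v : 'I_n -> U, exists x, C x /\ forall i, K (v i) x) ->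
  exists x, C x /\ forall u, K u x.
Proof.
move=> cC vC clK vK [z Kz] CK.
have Cc := cC; rewrite compact_In0/= in Cc.
have [||x xP] := Cc {classic U} setT (fun u => C `&` K u).
- by exists K => // u _; exact: clK.
- move=> D _.
  pose F (o : option D) := if o is Some u then K (\val u) else C.
  have [[u|]|B cB|x xF] := @helly R n _ F.
  + exact: vK.
  + exact: vC.
  + have [NB|NB] := boolP (None \in B); last first.
      by exists z => -[u _|/(negP NB)//]; exact: Kz.
    (* Removing [None], the index of [C], leaves at most [n] constraints; [nth] pads their list with
       [u0] to a full sample. *)
    pose s := [seq \val u | u <- enum [pred u : D | Some u \in B]].
    have ss : (size s <= n)%N.
      rewrite size_map -cardE -(fintype.card_image (@Some_inj _)).
      rewrite -ltnS (leq_trans _ cB)// (cardsD1 None) NB add1n ltnS.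
      apply: subset_leq_card; apply/fintype.subsetP => o /fintype.imageP[u].
      by move=> uB ->; rewrite in_setD1 /=; exact: uB.
    have [x [Cx Kx]] := CK (fun i : 'I_n => nth u0 s i).
    exists x => -[u uB|//]; rewrite /F.
    have us : \val u \in s.
      by apply: map_f; rewrite mem_enum.
    have iu : (index (\val u) s < n)%N by rewrite (leq_trans _ ss)// index_mem.
    have <- : nth (u0 : {classic U}) s (index (\val u) s) = \val u.
      exact: nth_index.
    exact: Kx (Ordinal iu).
  + exists x => u uD; split; first exact: (xF None).
    by have := xF (Some [`uD]%fset).
- exists x; split; first by have [] := xP u0 Logic.I.
  by move=> u; have [] := xP u Logic.I.
Qed.

(** * Semicontinuity and existence of minimizers *)

Lemma lsc_onP (R : realType) (T : topologicalType) (D : set T) (phi : T -> R) :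
  lsc_on D phi <-> forall x c, D x -> c < phi x ->
    \forall y \near x, D y -> c < phi y.
Proof.
split=> [lphi x c Dx cx|lphi x c]; last rewrite lte_fin => cx.
  have [|W xW Wphi] := lphi x c; first by rewrite lte_fin.
  have : within D (nbhs x) W by rewrite (nbhs_subspace_in Dx).
  by rewrite /within/=; apply: filterS => y /[apply]/Wphi; rewrite lte_fin.
exists [set y | c < phi y]; last by move=> y; rewrite lte_fin.
have [Dx|nDx] := pselect (D x).
  apply: (eq_ind _ (@^~ [set y | c < phi y]) _ _ (nbhs_subspace_in Dx)).
  exact: lphi.
apply: (eq_ind _ (@^~ [set y | c < phi y]) _ _ (nbhs_subspace_out nDx)).
by move=> y ->.
Qed.

Lemma usc_on_near (R : realType) (T : topologicalType) (D : set T)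
    (phi : T -> R) x c :
  usc_on D phi -> D x -> phi x < c -> \forall y \near x, D y -> phi y < c.
Proof.
move=> /lsc_onP lphi Dx xc; have := lphi x (- c) Dx; rewrite ltrN2 => /(_ xc).
by apply: filterS => y /[apply]; rewrite ltrN2.
Qed.

Lemma lsc_on_closed_sublevel (R : realType) (T : topologicalType)
    (D A : set T) (phi : T -> R) c :
  lsc_on D phi -> A `<=` D -> closed A -> closed [set x | A x /\ phi x <= c].
Proof.
move=> /lsc_onP lphi AD cA x clx.
have Ax : A x by apply: cA => B /clx[y [[? _] ?]]; exists y.
split=> //; rewrite leNgt; apply/negP => cx.
have [y [[Ay yc] /(_ (AD _ Ay))]] := clx _ (lphi x c (AD _ Ax) cx).
by rewrite ltNge yc.
Qed.

(** Let [F] be the filter generated by the sublevel sets at values of [phi]. Without a minimizer,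
    each [x] in [A] has nearby points whose values exceed [phi y] for [y] far along [F]; compactness
    makes this uniform over [A], and a generating point [z] then satisfies [phi z < phi z]. *)
Lemma argmin_compact (R : realType) (T : topologicalType) (A : set T)
    (phi : T -> R) :
  lsc_on A phi -> compact A -> A !=set0 -> argmin A phi !=set0.
Proof.
move=> /lsc_onP lphi /compact_near_coveringP/near_covering_withinP cA [a0 Aa0].
apply: contrapT => /forallNP noMin.
pose F := filter_from A (fun z => [set y | A y /\ phi y <= phi z]).
have FF : Filter F.
  apply: filter_from_filter; first by exists a0.
  move=> y z Ay Az; have [yz|zy] := leP (phi y) (phi z).
    by exists y => // w [Aw wy]; split; split=> //; exact: le_trans yz.
  by exists z => // w [Aw wz]; split; split=> //; exact: le_trans (ltW zy).
have [|z Az zP] := cA _ F (fun y x => phi y < phi x) FF.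
  move=> x Ax; have /not_andP[//|] := noMin x.
  move=> /existsNP[z /not_implyP[Az /negP]]; rewrite -ltNge => zx.
  near=> x' y => /= Ax'; apply: (@le_lt_trans _ _ (phi z)).
    by near: y; exists z => // y [].
  by move: Ax'; near: x'; exact: lphi.
by have := zP z (conj Az (lexx _)) z Az; rewrite ltxx.
Unshelve. all: by end_near. Qed.

Lemma lsc_onS (R : realType) (T : topologicalType) (A D : set T)
    (phi : T -> R) :
  A `<=` D -> lsc_on D phi -> lsc_on A phi.
Proof.
move=> AD /lsc_onP lphi; apply/lsc_onP => x c Ax cx.
by apply: filterS (lphi x c (AD _ Ax) cx) => y yP /AD.
Qed.

Lemma continuous_lsc_on (R : realType) (T : topologicalType) (D : set T)
    (phi : T -> R) :
  {within D, continuous phi} -> lsc_on D phi.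
Proof.
move=> cphi x c; rewrite lte_fin => cx.
exists [set y | c < phi y]; last by move=> y; rewrite lte_fin.
exact: (cvgr_gt _ (cphi x)).
Qed.

Lemma lsc_onD (R : realType) (T : topologicalType) (D : set T)
    (phi psi : T -> R) :
  lsc_on D phi -> lsc_on D psi -> lsc_on D (fun x => phi x + psi x).
Proof.
move=> /lsc_onP lphi /lsc_onP lpsi; apply/lsc_onP => x c Dx cx.
pose d := (phi x + psi x - c) / 2.
have d0 : 0 < d by rewrite /d; lra.
have phid : phi x - d < phi x by lra.
have psid : psi x - d < psi x by lra.
apply: filterS2 (lphi _ _ Dx phid) (lpsi _ _ Dx psid).
by move=> y phiy psiy Dy; have := phiy Dy; have := psiy Dy; rewrite /d; lra.
Qed.

Lemma lsc_onM (R : realType) (T : topologicalType) (D : set T)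
    (phi : T -> R) a :
  0 < a -> lsc_on D phi -> lsc_on D (fun x => a * phi x).
Proof.
move=> a0 /lsc_onP lphi; apply/lsc_onP => x c Dx cx.
have /(lphi _ _ Dx) : c / a < phi x by rewrite ltr_pdivrMr// mulrC.
by apply: filterS => y /[apply]; rewrite ltr_pdivrMr// mulrC.
Qed.

(** The sublevel set at one point of [A] is compact, and values outside it are larger. *)
Lemma argmin_rV (R : realType) (n : nat) (A : set 'rV[R]_n)
    (phi : 'rV[R]_n -> R) :
  lsc_on A phi -> closed A -> A !=set0 ->
  (forall a, bounded_set [set x | A x /\ phi x <= a]) -> argmin A phi !=set0.
Proof.
move=> lphi cA [a0 Aa0] bA.
pose B := [set x | A x /\ phi x <= phi a0].
have BA : B `<=` A by move=> x [].
have [||x [[Ax xa0] xP]] := argmin_compact (lsc_onS BA lphi).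
- apply: bounded_closed_compact; first exact: bA.
  exact: lsc_on_closed_sublevel lphi (@subset_refl _ A) cA.
- by exists a0; split => //=.
exists x; split=> // y Ay; have [ya0|/ltW a0y] := leP (phi y) (phi a0).
  by apply: xP.
exact: le_trans a0y.
Qed.

(** * Convex functions, sublevel sets and feasible sets *)

Lemma bounded_setS (R : realType) (V : normedModType R) (A B : set V) :
  A `<=` B -> bounded_set B -> bounded_set A.
Proof. by move=> AB; rewrite /bounded_set/=; apply: filterS => M h x /AB/h. Qed.

Lemma convex_functionP (R : realType) (V : lmodType R) (D : set V)
    (f : V -> R) : convex_function D f ->
  forall x y t, D x -> D y -> 0 <= t -> t <= 1 ->
    f (t *: x + (1 - t) *: y) <= t * f x + (1 - t) * f y.
Proof.
move=> cf x y t Dx Dy t0 t1.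
exact: cf (Itv01 t0 t1) x y (mem_set Dx) (mem_set Dy).
Qed.

Lemma convex_sublevel (R : realType) (V : lmodType R) (D : set V)
    (f : V -> R) c :
  convex_set D -> convex_function D f -> convex_set [set x | D x /\ f x <= c].
Proof.
move=> /convex_setP cD /convex_functionP cf; apply/convex_setP.
move=> x y t [Dx xc] [Dy yc] t0 t1; split; first exact: cD.
apply: le_trans (cf _ _ _ Dx Dy t0 t1) _; nra.
Qed.

Lemma strictly_convex_convex (R : realType) (V : lmodType R) (D : set V)
    (f : V -> R) : strictly_convex_on D f -> convex_function D f.
Proof.
move=> scf t x y /set_mem Dx /set_mem Dy.
have [<-|xy] := eqVneq x y; first by rewrite !convmm.
have [->|t0] := eqVneq t 0%:i01; first by rewrite !conv0.
have [->|t1] := eqVneq t 1%:i01; first by rewrite !conv1.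
apply/ltW/scf => //; rewrite !lt_neqAle ge0 le1 !andbT eq_sym.
by rewrite t0 t1.
Qed.

Lemma strictly_convexD (R : realType) (V : lmodType R) (D : set V)
    (f h : V -> R) (e : R) : 0 < e ->
  convex_function D f -> strictly_convex_on D h ->
  strictly_convex_on D (fun x => f x + e * h x).
Proof.
move=> e0 /convex_functionP cf sch x y l Dx Dy xy /[dup] l01 /andP[l0 l1].
have := cf _ _ _ Dx Dy (ltW l0) (ltW l1).
have := sch _ _ _ Dx Dy xy l01; rewrite -(ltr_pM2l e0).
lra.
Qed.

Lemma strictly_convex_argmin_uniq (R : realType) (V : lmodType R) (A : set V)
    (f : V -> R) : convex_set A -> strictly_convex_on A f ->
  forall x y, argmin A f x -> argmin A f y -> x = y.
Proof.
move=> /convex_setP cA scf x y [Ax xP] [Ay yP]; apply: contrapT => /eqP xy.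
have h01 : 0 < (2^-1 : R) < 1 by lra.
have := scf _ _ _ Ax Ay xy h01.
have := xP _ (cA _ _ _ Ax Ay (ltW (andP h01).1) (ltW (andP h01).2)).
have := xP _ Ay; have := yP _ Ax; lra.
Qed.

Lemma strictly_convex_onS (R : realType) (V : lmodType R) (A D : set V)
    (f : V -> R) :
  A `<=` D -> strictly_convex_on D f -> strictly_convex_on A f.
Proof. by move=> AD scf x y l /AD Dx /AD Dy; exact: scf. Qed.

Lemma quasiconvex_sublevel (R : realType) (V : lmodType R) (D : set V)
    (f : V -> R) c :
  convex_set D -> strictly_quasiconvex_on D f ->
  convex_set [set x | D x /\ f x <= c].
Proof.
move=> /convex_setP cD qf; apply: convex_set_distinct.
move=> x y t [Dx xc] [Dy yc] xy /[dup] t01 /andP[t0 t1].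
split; first by apply: cD => //; exact: ltW.
by rewrite (le_trans (ltW (qf _ _ _ Dx Dy xy t01)))// ge_max xc.
Qed.

Lemma feasible_convex (R : realType) (V : lmodType R) (I : Type) (D : set V)
    (c : V -> I -> R) :
  convex_set D -> (forall i, strictly_quasiconvex_on D (c ^~ i)) ->
  convex_set (feasible D c).
Proof.
move=> cD qc; apply/convex_setP => x y t [Dx xc] [Dy yc] t0 t1.
split; first by move/convex_setP : cD; exact.
move=> i; have /convex_setP := quasiconvex_sublevel (c := 0) cD (qc i).
by move=> /(_ x y t)[].
Qed.

Lemma feasible_closed (R : realType) (T : topologicalType) (I : Type)
    (D : set T) (c : T -> I -> R) :
  closed D -> (forall i, closed [set x | D x /\ c x i <= 0]) ->
  closed (feasible D c).
Proof.
move=> cD cc x clx; split.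
  by apply: cD => B /clx[y [[? _] ?]]; exists y.
by move=> i; have [] // := cc i x; move=> B /clx[y [[? yc] ?]]; exists y.
Qed.

Lemma optimal_value_argmin (R : realType) (V : Type) (A : set V)
    (F : V -> R) x : argmin A F x -> optimal_value A F = F x.
Proof.
move=> [Ax xP]; apply/eqP; rewrite eq_le; apply/andP; split.
  by apply: ge_inf; [exists (F x) => _ [y Ay <-]; exact: xP|exists x].
by apply: lb_le_inf; [exists (F x); exists x|move=> _ [y Ay <-]; exact: xP].
Qed.

(** * A sample that already enforces the optimal value *)

(** This bounds the maximum of [msa_G] from below; the upper bound is immediate, as sampling relaxes
    the constraints. *)
Theorem active_sample (R : realType) (n : nat) (U : topologicalType)
    (X : set 'rV[R]_n) (phi : 'rV[R]_n -> R) (g : 'rV[R]_n -> U -> R)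
    (xmin : 'rV[R]_n) :
    closed X -> convex_set X -> convex_function X phi -> lsc_on X phi ->
    (forall a, bounded_set [set x | X x /\ phi x <= a]) ->
    usc_on (X `*` [set: U]) (fun p => g p.1 p.2) ->
    (forall u, strictly_quasiconvex_on X (g ^~ u)) ->
    (forall u, closed [set x | X x /\ g x u <= 0]) ->
    compact [set: U] -> [set: U] !=set0 -> argmin (feasible X g) phi xmin ->
  exists u : 'I_n -> U,
    forall x, sampled_feasible X g u x -> phi xmin <= phi x.
Proof.
move=> clX cX cphi lphi bphi ug qg clg cU [u0 _] [[Xm gm] mP].
apply: contrapT => /forallNP noSample.
pose V := phi xmin.
have cUn : compact [set: {ptws 'I_n -> U}].
  have := @tychonoff 'I_n (fun=> U) (fun=> setT) (fun=> cU).
  by congr compact; apply/seteqP; split.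
pose P (c : R) (v : {ptws 'I_n -> U}) :=
  exists x, sampled_feasible X g v x /\ phi x <= c.
(* The level [c] runs along the left neighbourhoods of [V], so compactness of the space of samples
   turns levels valid locally into one valid for all samples. *)
have [c [cV cP]] : exists c, c < V /\ [set: {ptws 'I_n -> U}] `<=` P c.
  apply: (@filter_ex _ V^'-).
  apply: filterI; first exact: nbhs_left_lt.
  apply: (iffLR (compact_near_coveringP _) cUn R V^'- P) => v _.
  have /existsNP[x /not_implyP[[Xx gx] /negP]] := noSample v.
  rewrite -ltNge => xV.
  have xm : x != xmin by apply: contraTneq xV => ->; rewrite ltxx.
  pose y := 2^-1 *: x + (1 - 2^-1) *: xmin.
  have h01 : 0 < (2^-1 : R) < 1 by lra.
  have [h0 h1] := andP h01.
  have Xy : X y by move/convex_setP : cX; apply => //; exact: ltW.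
  have yV : phi y < V.
    have := convex_functionP cphi Xx Xm (ltW h0) (ltW h1).
    by rewrite -/y -/V; move: xV; rewrite -/V; lra.
  have gy i : g y (v i) < 0.
    apply: lt_le_trans (qg _ _ _ _ Xx Xm xm h01) _.
    by rewrite ge_max gx gm.
  have gyv : \forall v' \near v, forall i, g y (v' i) < 0.
    apply: (@filter_forall {ptws 'I_n -> U} 'I_n
      (fun i v' => g y (v' i) < 0) (nbhs v) (nbhs_filter v)) => i.
    (* Joint semicontinuity is used on the slice with [y] fixed; evaluation at [i] is continuous for
       pointwise convergence. *)
    have [[A B] /= [Ay Bv] AB] := usc_on_near (D := X `*` [set: U])
      (x := (y, v i)) ug (conj Xy Logic.I) (gy i).
    have : \forall v' \near v, B (proj i v') by exact: proj_continuous.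
    apply: filterS => v' Bv'.
    apply: (AB (y, v' i)) => //; split=> //=; exact: nbhs_singleton.
  exists ([set v' : {ptws 'I_n -> U} | forall i, g y (v' i) < 0],
          [set c | phi y <= c]) => /=.
    by split; [exact: gyv|exact: nbhs_left_ge].
  by move=> [v' c] /= [gv' yc]; exists y; split=> //; split=> // i; exact: ltW.
have [||||||x [[Xx xc] xK]] := @compact_helly R n U u0
    [set x | X x /\ phi x <= c] (fun u => [set x | X x /\ g x u <= 0]).
- apply: bounded_closed_compact; first exact: bphi.
  exact: lsc_on_closed_sublevel lphi (@subset_refl _ X) clX.
- exact: convex_sublevel.
- exact: clg.
- by move=> u; exact: quasiconvex_sublevel (qg u).
- by exists xmin => u; split.
- move=> v; have [x [[Xx gx] xc]] := cP v Logic.I.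
  by exists x; split=> // i; split.
have /mP : feasible X g x by split=> // u; have [] := xK u.
by rewrite leNgt (le_lt_trans xc).
Qed.

(** * Exactness of the algorithm and the limit of vanishing regularization *)

Unset Implicit Arguments.

Theorem mainTheorem1 (R : realType) (n : nat) (hn : (1 <= n)%N)
    (U : topologicalType) (X : set 'rV[R]_n)
    (f h : 'rV[R]_n -> R) (g : 'rV[R]_n -> U -> R)
    (X_closed : closed X)
    (X_convex : convex_set X)
    (X_int : interior X !=set0)
    (feas_int : interior (feasible X g) !=set0)
    (f_convex : convex_function X f)
    (f_cont : {within X, continuous f})
    (f_sublevel : forall a : R, bounded_set [set x | X x /\ f x <= a])
    (g_usc : usc_on (X `*` [set: U]) (fun p => g p.1 p.2))
    (g_sqc : forall u : U, strictly_quasiconvex_on X (g ^~ u))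
    (g_closed : forall u : U, closed [set x | X x /\ g x u <= 0])
    (U_compact : compact [set: U])
    (U_nonempty : [set: U] !=set0)
    (h_pos : forall x, X x -> 0 < h x)
    (h_sconvex : strictly_convex_on X h)
    (h_lsc : lsc_on X h) :
  (forall eps : R, 0 < eps ->
     exists x_eps : 'rV[R]_n,
       [/\ argmin (feasible X g) (reg_objective f h eps) = [set x_eps],
           msa_maximizers X f h g eps !=set0 &
           forall u, msa_maximizers X f h g eps u ->
             argmin (sampled_feasible X g u) (reg_objective f h eps)
             = [set x_eps]])
  /\
  (forall (eps_ : nat -> R) (x_ : nat -> 'rV[R]_n),
     (forall k, 0 < eps_ k) ->
     eps_ @ \oo --> (0 : R) ->
     (forall k, msa_outputs X f h g (eps_ k) (x_ k)) ->
     minimizing_sequence X f g x_ /\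
     exists2 x_star, argmin (feasible X g) f x_star & x_ @ \oo --> x_star).
Proof.
have FX : feasible X g `<=` X by move=> x [].
have clF : closed (feasible X g) by exact: feasible_closed.
have cF : convex_set (feasible X g) by exact: feasible_convex.
have F0 : feasible X g !=set0.
  by case: feas_int => x /interior_subset Fx; exists x.
have f_lsc := continuous_lsc_on f_cont.
have reg_sc (eps : R) : 0 < eps -> strictly_convex_on X (reg_objective f h eps).
  by move=> e0; exact: strictly_convexD.
have reg_lsc (eps : R) : 0 < eps -> lsc_on X (reg_objective f h eps).
  by move=> e0; apply: lsc_onD => //; exact: lsc_onM.
have reg_bounded (eps a : R) : 0 < eps ->
    bounded_set [set x | X x /\ reg_objective f h eps x <= a].
  move=> e0; apply: bounded_setS (f_sublevel a) => x [Xx xa]; split=> //.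
  apply: le_trans xa; rewrite /reg_objective lerDl mulr_ge0// ltW//.
  exact: h_pos.
(* The constraint family is left arbitrary so as to cover both the full and the sampled programs. *)
have reg_argmin (eps : R) (I : Type) (c : 'rV[R]_n -> I -> R) : 0 < eps ->
    (forall i, closed [set x | X x /\ c x i <= 0]) -> feasible X c !=set0 ->
    argmin (feasible X c) (reg_objective f h eps) !=set0.
  move=> e0 clc Fc0; have FcX : feasible X c `<=` X by move=> x [].
  apply: argmin_rV => //.
  - exact: lsc_onS FcX (reg_lsc _ e0).
  - exact: feasible_closed.
  - by move=> a; apply: bounded_setS (reg_bounded _ a e0) => x [/FcX].
have reg_uniq (eps : R) (I : Type) (c : 'rV[R]_n -> I -> R) : 0 < eps ->
    (forall i, strictly_quasiconvex_on X (c ^~ i)) ->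
    forall x, argmin (feasible X c) (reg_objective f h eps) x ->
    argmin (feasible X c) (reg_objective f h eps) = [set x].
  move=> e0 qc x xmin; apply/seteqP; split=> [y ymin|y ->//].
  apply: strictly_convex_argmin_uniq ymin xmin; first exact: feasible_convex.
  by apply: strictly_convex_onS (reg_sc _ e0) => z [].
have exact_run (eps : R) : 0 < eps -> exists x_eps : 'rV[R]_n,
    [/\ argmin (feasible X g) (reg_objective f h eps) = [set x_eps],
        msa_maximizers X f h g eps !=set0 &
        forall u, msa_maximizers X f h g eps u ->
          argmin (sampled_feasible X g u) (reg_objective f h eps)
          = [set x_eps]].
  move=> e0; have [x xmin] := reg_argmin eps U g e0 g_closed F0.
  have [[Xx gx] xP] := xmin.
  have sx (u : 'I_n -> U) : sampled_feasible X g u x by split.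
  have sampled_argmin (u : 'I_n -> U) :
      argmin (sampled_feasible X g u) (reg_objective f h eps) !=set0.
    by apply: reg_argmin => //; exists x.
  have G_le u : msa_G X f h g eps u <= reg_objective f h eps x.
    have [y ymin] := sampled_argmin u.
    by rewrite /msa_G (optimal_value_argmin ymin); exact: ymin.2.
  have [u0 u0P] := active_sample X_closed X_convex
    (strictly_convex_convex (reg_sc _ e0)) (reg_lsc _ e0)
    (fun a => reg_bounded _ a e0) g_usc g_sqc g_closed U_compact U_nonempty
    xmin.
  have G_u0 : reg_objective f h eps x <= msa_G X f h g eps u0.
    have [y ymin] := sampled_argmin u0.
    by rewrite /msa_G (optimal_value_argmin ymin); apply: u0P ymin.1.
  exists x; split.
  - exact: reg_uniq.
  - by exists u0 => v; exact: le_trans G_u0.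
  (* The full minimizer [x] is feasible for [u] and its value is at most [msa_G] at [u0], hence at
     most the sampled optimum at the maximizer [u]; so it attains that optimum. *)
  - move=> u umax; apply: reg_uniq => //; split=> // y sy.
    apply: le_trans G_u0 (le_trans (umax u0) _).
    have [z zmin] := sampled_argmin u.
    by rewrite /msa_G (optimal_value_argmin zmin); exact: zmin.2.
split=> // eps_ x_ eps_gt0 eps0 x_out.
have x_min k : argmin (feasible X g) (reg_objective f h (eps_ k)) (x_ k).
  have [x [-> _ xP]] := exact_run _ (eps_gt0 k).
  by have [u /xP ->] := x_out k.
have [x0 [Fx0 x0P]] : argmin (feasible X g) f !=set0.
  apply: argmin_rV => //; first exact: lsc_onS FX f_lsc.
  by move=> a; apply: bounded_setS (f_sublevel a) => x [/FX].
pose S := [set x | feasible X g x /\ f x <= f x0].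
have SX : S `<=` X by move=> x [/FX].
have [xs [[Fxs xs0] xsP]] : argmin S h !=set0.
  apply: argmin_rV.
  - exact: lsc_onS SX h_lsc.
  - exact: lsc_on_closed_sublevel f_lsc FX clF.
  - by exists x0.
  - by move=> a; apply: bounded_setS (f_sublevel (f x0)) => x [[/FX]].
have xs_min : argmin (feasible X g) f xs.
  by split=> // y Fy; apply: le_trans xs0 (x0P _ Fy).
have x_h k : h (x_ k) <= h xs.
  have [Fxk xkP] := x_min k.
  have := xkP _ Fxs; rewrite /reg_objective => le1.
  by have := xs_min.2 _ Fxk => le2; rewrite -(ler_pM2l (eps_gt0 k)); lra.
have x_f k : f (x_ k) <= f xs + eps_ k * h xs.
  have [Fxk xkP] := x_min k.
  have := xkP _ Fxs; rewrite /reg_objective => le1.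
  have : 0 <= eps_ k * h (x_ k) by rewrite mulr_ge0 ?ltW//; exact/h_pos/FX.
  lra.
have bound_cvg : (fun k => f xs + eps_ k * h xs) @ \oo --> f xs.
  rewrite -[X in _ --> X]addr0 -[X in _ --> _ + X](mul0r (h xs)).
  by apply: cvgD; [exact: cvg_cst|apply: cvgMl].
split; first split.
- by move=> k; have [] := x_min k.
- rewrite (optimal_value_argmin xs_min).
  apply: squeeze_cvgr (cvg_cst (f xs)) bound_cvg.
  by apply: nearW => k /=; rewrite x_f andbT; apply: xs_min.2; case: (x_min k).
exists xs => // W xsW.
(* Any level above [f xs] would do: [K] is compact and contains [x_ k] for all large [k]. *)
pose K := [set x | feasible X g x /\ f x <= f xs + 1].
have K_compact : compact K.
  apply: bounded_closed_compact.
    by apply: bounded_setS (f_sublevel (f xs + 1)) => x [/FX].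
  exact: lsc_on_closed_sublevel f_lsc FX clF.
pose P k x := f x <= f xs + eps_ k * h xs -> h x <= h xs -> W x.
have S_convex : convex_set S.
  apply: convex_sublevel => // t x y /set_mem/FX Xx /set_mem/FX Xy.
  by apply: f_convex; exact: mem_set.
have KP : \forall k \near \oo, K `<=` P k.
  apply: (iffRL (near_covering_withinP _)
    (iffLR (compact_near_coveringP _) K_compact)).
  move=> x [Fx _].
  have [->|x_neq] := eqVneq x xs.
    by near=> x' k => /= _ _ _; near: x'.
  (* If both bounds held at [x], it would be a second minimizer of [h] on the convex set [S]. *)
  have : f xs < f x \/ h xs < h x.
    apply: contrapT => /not_orP[/negP + /negP]; rewrite -!leNgt => fx hx.
    move/eqP: x_neq; apply.
    have Sx : S x by split=> //; exact: le_trans xs0.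
    apply: (strictly_convex_argmin_uniq S_convex
      (strictly_convex_onS SX h_sconvex)) => //.
    by split=> // y /xsP; exact: le_trans.
  case=> [fx|hx].
    (* The level [c] separates the two sides: [f] stays above it near [x], while the bound on
       [f (x_ k)] eventually falls below it. *)
    pose c := (f xs + f x) / 2.
    have cx : c < f x by rewrite /c; lra.
    have xsc : f xs < c by rewrite /c; lra.
    near=> x' k => /= -[Fx' _] fx' _; exfalso.
    have : c < f x'.
      move: (FX _ Fx'); near: x'.
      exact: (lsc_onP X f).1 f_lsc x c (FX _ Fx) cx.
    apply/negP; rewrite -leNgt (le_trans fx')// ltW//.
    by near: k; exact: (cvgr_lt _ bound_cvg).
  (* The bound on [h] does not depend on [k], so semicontinuity of [h] at [x] alone excludes nearby
     points. *)
  near=> x' k => /= -[Fx' _] _ hx'; exfalso; move: hx'; apply/negP.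
  rewrite -ltNge; move: (FX _ Fx'); near: x'.
  exact: (lsc_onP X h).1 h_lsc x (h xs) (FX _ Fx) hx.
have near1 : \forall k \near \oo, f xs + eps_ k * h xs < f xs + 1.
  by apply: (cvgr_lt _ bound_cvg); rewrite ltrDl.
suff : \forall k \near \oo, W (x_ k) by [].
apply: filterS2 KP near1 => k KPk /ltW k1; apply: KPk => //.
by split; [case: (x_min k)|exact: le_trans (x_f k) k1].
Unshelve. all: by end_near. Qed.
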